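(* Let $B$ be a supersoluble brace. Then $B/\operatorname{Fit}(B)$ is finite.
   Context: A brace (skew left brace) is a set $B$ with two binary operations $+$ and $\cdot$ such that $(B,+)$ and $(B,\cdot)$ are groups and $a(b+c)=ab-a+ac$ for all $a,b,c\in B$. $\lambda_a(b)=-a+ab$ defines a homomorphism $\lambda\colon(B,\cdot)\to\operatorname{Aut}(B,+)$. An ideal is a subset that is a subgroup of both groups, normal in both, and invariant under all $\lambda_b$; quotients by ideals are braces. $\operatorname{Soc}(B)=\operatorname{Ker}\lambda\cap Z(B,+)$ and $\zeta(B)=\operatorname{Soc}(B)\cap Z(B,\cdot)$. An ideal $I$ of $B$ is $B$-centrally nilpotent if there is a finite chain $\{0\}=I_0\le\dots\le I_n=I$ of ideals of $B$ with $I_{i+1}/I_i\le\zeta(I/I_i)$ for all $i$. The Fitting ideal $\operatorname{Fit}(B)$ is the sum (additive subgroup generated) of all $B$-centrally nilpotent ideals of $B$; it is an ideal. $B$ is supersoluble if there is a finite chain of ideals $\{0\}=J_0\le\dots\le J_n=B$ such that for each $i$, either $(J_{i+1}/J_i,+)$ is infinite cyclic and $J_{i+1}/J_i\le\operatorname{Soc}(B/J_i)$, or $J_{i+1}/J_i$ has prime order. *)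

(* Defs.v *)
From Stdlib Require Import List ZArith Znumtheory.
Import ListNotations.
Set Implicit Arguments.
Local Open Scope nat_scope.

(** A (skew left) brace: (B,+) and (B,.) groups with a(b+c) = ab - a + ac.
    (B,+) is not assumed abelian. *)
Record brace := Brace {
  car :> Type;
  add : car -> car -> car;
  opp : car -> car;
  zero : car;
  mul : car -> car -> car;
  inv : car -> car;
  one : car;
  addA : forall a b c, add a (add b c) = add (add a b) c;
  add0r : forall a, add zero a = a;
  addr0 : forall a, add a zero = a;
  addNr : forall a, add (opp a) a = zero;
  addrN : forall a, add a (opp a) = zero;
  mulA : forall a b c, mul a (mul b c) = mul (mul a b) c;
  mul1r : forall a, mul one a = a;
  mulr1 : forall a, mul a one = a;
  mulVr : forall a, mul (inv a) a = one;
  mulrV : forall a, mul a (inv a) = one;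
  brace_law : forall a b c, mul a (add b c) = add (add (mul a b) (opp a)) (mul a c)
}.

Arguments add {b0} _ _.
Arguments opp {b0} _.
Arguments mul {b0} _ _.
Arguments inv {b0} _.

Section BraceDefs.
Variable B : brace.
Local Notation "x + y" := (add x y).
Local Notation "- x" := (opp x).
Local Notation "x * y" := (mul x y).

Definition lam (a b : B) : B := - a + a * b.

Definition is_ideal (I : B -> Prop) : Prop :=
  I (zero B) /\
  (forall x y, I x -> I y -> I (x + y)) /\
  (forall x, I x -> I (- x)) /\
  (forall x y, I x -> I y -> I (x * y)) /\
  (forall x, I x -> I (inv x)) /\
  (forall a x, I x -> I (a + x + - a)) /\
  (forall a x, I x -> I (a * x * inv a)) /\
  (forall a x, I x -> I (lam a x)).

Definition cong (J : B -> Prop) (x y : B) : Prop := J (- x + y).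

Definition subset (I J : B -> Prop) : Prop := forall x, I x -> J x.

(** x + J lies in zeta(I/J) = Soc(I/J) ∩ Z(I/J,.), where J ⊆ I are ideals of B. *)
Definition in_zeta_quot (I J : B -> Prop) (x : B) : Prop :=
  forall y, I y ->
    cong J (lam x y) y /\ cong J (x + y) (y + x) /\ cong J (x * y) (y * x).

(** x + J lies in Soc(B/J) = Ker lambda ∩ Z(B/J,+). *)
Definition in_soc_quot (J : B -> Prop) (x : B) : Prop :=
  forall y, cong J (lam x y) y /\ cong J (x + y) (y + x).

Definition B_centrally_nilpotent (I : B -> Prop) : Prop :=
  is_ideal I /\
  exists (n : nat) (K : nat -> B -> Prop),
    (forall x, K 0 x <-> x = zero B) /\
    (forall x, K n x <-> I x) /\
    (forall i, i <= n -> is_ideal (K i)) /\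
    (forall i, i < n -> subset (K i) (K (S i))) /\
    (forall i, i < n -> forall x, K (S i) x -> in_zeta_quot I (K i) x).

Inductive Fit : B -> Prop :=
  | Fit_zero : Fit (zero B)
  | Fit_gen : forall I x, B_centrally_nilpotent I -> I x -> Fit x
  | Fit_add : forall x y, Fit x -> Fit y -> Fit (x + y)
  | Fit_opp : forall x, Fit x -> Fit (- x).

Definition zmul (g : B) (k : Z) : B :=
  match k with
  | Z0 => zero B
  | Zpos p => Nat.iter (Pos.to_nat p) (fun y => g + y) (zero B)
  | Zneg p => - Nat.iter (Pos.to_nat p) (fun y => g + y) (zero B)
  end.

Definition quot_infinite_cyclic (K J : B -> Prop) : Prop :=
  exists g, K g /\
    (forall x, K x -> exists k : Z, cong J x (zmul g k)) /\
    (forall k : Z, J (zmul g k) -> k = 0%Z).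

Definition quot_card (K J : B -> Prop) (m : nat) : Prop :=
  exists l : list B, length l = m /\ Forall K l /\
    (forall x, K x -> exists y, In y l /\ cong J y x) /\
    (forall a b, a < m -> b < m -> cong J (nth a l (zero B)) (nth b l (zero B)) -> a = b).

Definition supersoluble : Prop :=
  exists (n : nat) (J : nat -> B -> Prop),
    (forall x, J 0 x <-> x = zero B) /\
    (forall x, J n x) /\
    (forall i, i <= n -> is_ideal (J i)) /\
    (forall i, i < n -> subset (J i) (J (S i))) /\
    (forall i, i < n ->
       (quot_infinite_cyclic (J (S i)) (J i) /\
        forall x, J (S i) x -> in_soc_quot (J i) x)
       \/ (exists p, prime (Z.of_nat p) /\ quot_card (J (S i)) (J i) p)).

Definition quot_finite (J : B -> Prop) : Prop :=
  exists l : list B, forall b : B, exists y, In y l /\ cong J y b.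

End BraceDefs.

(* Main.v *)
(* Along the given chain J_0 <= ... <= J_n one builds, downwards, an ideal of finite
   index that is centrally nilpotent modulo J_i: intersect the one for i + 1 with a
   finite-index ideal C centralizing J_(i+1)/J_i. For finite E/A such ideals come from
   residual finiteness, i.e. a finite-index ideal L with L /\ E <= A, since commutators
   of an ideal L with an ideal E lie in L /\ E.

   Residual finiteness rests on the following: if E/J is finite and D/E = <g> lies in
   Soc(B/E), there is N > 0 such that, modulo J, the additive N x and the
   multiplicative x^N depend only on x modulo E. Then N^2 g = g^(N^2) modulo J, and
   J + <N^2 g> is an ideal, being both an additive subgroup invariant under lambda and
   conjugation and a multiplicative subgroup invariant under conjugation.

   Quotients are never formed: a quotient group is a group up to the relation [eqv]. *)
Require Import Defs.
From Stdlib Require Import List ZArith Znumtheory Lia Setoid Morphisms.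
From Stdlib Require Import Classical ClassicalEpsilon.
Import ListNotations.
Local Open Scope nat_scope.

(** * Groups up to an equivalence relation and their integer powers *)

Class SGroup (T : Type) (eqv : relation T) (op : T -> T -> T) (e : T) (i : T -> T)
  : Prop := {
  sg_equiv :: Equivalence eqv;
  sg_op :: Proper (eqv ==> eqv ==> eqv) op;
  sg_assoc : forall x y z, eqv (op x (op y z)) (op (op x y) z);
  sg_idl : forall x, eqv (op e x) x;
  sg_idr : forall x, eqv (op x e) x;
  sg_invl : forall x, eqv (op (i x) x) e;
  sg_invr : forall x, eqv (op x (i x)) e
}.

(* Instantiated with the additive group of a brace this is convertible to [zmul]. *)
Definition zpow (T : Type) (op : T -> T -> T) (e : T) (i : T -> T) (g : T) (k : Z) : T :=
  match k with
  | Z0 => e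
  | Zpos p => Nat.iter (Pos.to_nat p) (fun y => op g y) e
  | Zneg p => i (Nat.iter (Pos.to_nat p) (fun y => op g y) e)
  end.
Arguments zpow {T} op e i g k.

Section Group.
Context {T : Type} {eqv : relation T} {op : T -> T -> T} {e : T} {i : T -> T}
  {SG : SGroup T eqv op e i}.
Local Infix "==" := eqv (at level 70).
Local Infix "*" := op.
Local Notation "x ^ k" := (zpow op e i x k).

Lemma sg_idl_unique x y : x * y == y -> x == e.
Proof.
  intros H. rewrite <- (sg_idr x), <- (sg_invr y), sg_assoc, H. reflexivity.
Qed.

Lemma sg_inv_unique x y : x * y == e -> x == i y.
Proof.
  intros H. rewrite <- (sg_idr x), <- (sg_invr y), sg_assoc, H, sg_idl. reflexivity.
Qed.

Global Instance sg_inv_proper : Proper (eqv ==> eqv) i.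
Proof.
  intros x y H. apply sg_inv_unique. rewrite <- H. apply sg_invl.
Qed.

Lemma sg_op_inv x y : i (x * y) == i y * i x.
Proof.
  symmetry. apply sg_inv_unique.
  rewrite <- sg_assoc, (sg_assoc (i x)), sg_invl, sg_idl. apply sg_invl.
Qed.

Lemma sg_inv_inv x : i (i x) == x.
Proof. symmetry. apply sg_inv_unique, sg_invr. Qed.

Lemma sg_inv_id : i e == e.
Proof. symmetry. apply sg_inv_unique, sg_idl. Qed.

Lemma sg_keyl x y : i x * (x * y) == y.
Proof. rewrite sg_assoc, sg_invl. apply sg_idl. Qed.

Lemma sg_keyr x y : x * (i x * y) == y.
Proof. rewrite sg_assoc, sg_invr. apply sg_idl. Qed.

Lemma sg_assoc_r x y z : (x * y) * z == x * (y * z).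
Proof. symmetry; apply sg_assoc. Qed.

Ltac gsimpl := repeat first
  [ rewrite sg_assoc_r | rewrite sg_op_inv | rewrite sg_inv_inv | rewrite sg_inv_id
  | rewrite sg_keyl | rewrite sg_keyr | rewrite sg_idl | rewrite sg_idr
  | rewrite sg_invl | rewrite sg_invr ].

Lemma sg_cancel_l x y z : x * y == x * z -> y == z.
Proof. intros H. rewrite <- (sg_keyl x y), H. apply sg_keyl. Qed.

Lemma sg_cancel_r x y z : y * x == z * x -> y == z.
Proof.
  intros H. rewrite <- (sg_idr y), <- (sg_idr z), <- (sg_invr x), !sg_assoc, H.
  reflexivity.
Qed.

Lemma zpow_1 x : x ^ 1 == x.
Proof. change (x * e == x). apply sg_idr. Qed.

Lemma zpow_succ x k : x ^ (Z.succ k) == x * x ^ k.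
Proof.
  assert (P : forall p, Nat.iter (Pos.to_nat (Pos.succ p)) (fun y => x * y) e
    = x * Nat.iter (Pos.to_nat p) (fun y => x * y) e)
    by (intros p; rewrite Pos2Nat.inj_succ; reflexivity).
  destruct k as [|p|p].
  - reflexivity.
  - rewrite <- Pos2Z.inj_succ. cbn [zpow]. rewrite P. reflexivity.
  - destruct (Pos.eq_dec p 1) as [->|n].
    + change (e == x * i (x * e)). gsimpl. reflexivity.
    + destruct (Pos.succ_pred_or p) as [|E]; [contradiction|].
      revert E. generalize (Pos.pred p) as q. intros q <-.
      replace (Z.succ (Zneg (Pos.succ q))) with (Zneg q) by lia.
      cbn [zpow]. rewrite P.
      (* Inverting [x * w] puts [i x] on the right, so [x] is first moved to the other end of the
         product [w]. *)
      assert (C : forall m, Nat.iter m (fun y => x * y) e * x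
        == x * Nat.iter m (fun y => x * y) e).
      { induction m as [|m IH]; [cbn; gsimpl; reflexivity|].
        cbn [Nat.iter nat_rect]. rewrite sg_assoc_r, IH. reflexivity. }
      rewrite <- C. gsimpl. reflexivity.
Qed.

Lemma zpow_pred x k : x ^ (Z.pred k) == i x * x ^ k.
Proof.
  rewrite <- (Z.succ_pred k) at 2. rewrite zpow_succ. symmetry. apply sg_keyl.
Qed.

Lemma zpow_add x a b : x ^ (a + b) == x ^ a * x ^ b.
Proof.
  induction a as [|a IH|a IH] using Z.peano_ind.
  - cbn. rewrite sg_idl. reflexivity.
  - rewrite Z.add_succ_l, !zpow_succ, IH. apply sg_assoc.
  - rewrite Z.add_pred_l, !zpow_pred, IH. apply sg_assoc.
Qed.

Lemma zpow_opp x a : x ^ (- a) == i (x ^ a).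
Proof.
  apply sg_inv_unique. rewrite <- zpow_add, Z.add_opp_diag_l. reflexivity.
Qed.

Lemma zpow_mul x a b : x ^ (a * b) == (x ^ a) ^ b.
Proof.
  induction b as [|b IH|b IH] using Z.peano_ind.
  - rewrite Z.mul_0_r. reflexivity.
  - rewrite Z.mul_succ_r, Z.add_comm, zpow_add, zpow_succ, IH. reflexivity.
  - rewrite Z.mul_pred_r, zpow_pred, <- IH, <- zpow_opp, <- zpow_add.
    rewrite Z.add_comm. reflexivity.
Qed.

Global Instance zpow_proper : Proper (eqv ==> eq ==> eqv) (zpow op e i).
Proof.
  intros x y H k ? <-. induction k as [|k IH|k IH] using Z.peano_ind.
  - reflexivity.
  - rewrite !zpow_succ, IH, H. reflexivity.
  - rewrite !zpow_pred, IH, H. reflexivity.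
Qed.

Lemma zpow_id k : e ^ k == e.
Proof.
  induction k as [|k IH|k IH] using Z.peano_ind.
  - reflexivity.
  - rewrite zpow_succ, IH. apply sg_idl.
  - rewrite zpow_pred, IH, sg_inv_id. apply sg_idl.
Qed.

Lemma zpow_morph (f : T -> T) (fP : Proper (eqv ==> eqv) f)
  (fM : forall x y, f (x * y) == f x * f y) x k : f (x ^ k) == f x ^ k.
Proof.
  assert (f1 : f e == e) by (apply (sg_idl_unique _ (f e)); rewrite <- fM, sg_idl; reflexivity).
  assert (fV : forall y, f (i y) == i (f y))
    by (intros y; apply sg_inv_unique; rewrite <- fM, sg_invl; exact f1).
  induction k as [|k IH|k IH] using Z.peano_ind.
  - exact f1.
  - rewrite !zpow_succ, fM, IH. reflexivity.
  - rewrite !zpow_pred, fM, IH, fV. reflexivity.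
Qed.

Lemma zpow_conj y x k : y * x ^ k * i y == (y * x * i y) ^ k.
Proof.
  apply (zpow_morph (fun z => y * z * i y)).
  - intros a b H. rewrite H. reflexivity.
  - intros a b. gsimpl. reflexivity.
Qed.

Lemma zpow_comm x y k : x * y == y * x -> x ^ k * y == y * x ^ k.
Proof.
  intros H. assert (C : y * x ^ k * i y == x ^ k).
  { rewrite zpow_conj, <- H. gsimpl. reflexivity. }
  transitivity (y * x ^ k * i y * y); [rewrite C; reflexivity|].
  gsimpl. reflexivity.
Qed.

Lemma zpow_closed (S : T -> Prop) (S_eqv : forall x y, x == y -> S x -> S y)
  (S_id : S e) (S_op : forall x y, S x -> S y -> S (x * y))
  (S_inv : forall x, S x -> S (i x)) x k : S x -> S (x ^ k).
Proof.
  intros H. induction k as [|k IH|k IH] using Z.peano_ind.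
  - exact S_id.
  - apply (S_eqv (x * x ^ k)); [symmetry; apply zpow_succ|auto].
  - apply (S_eqv (i x * x ^ k)); [symmetry; apply zpow_pred|auto].
Qed.

Lemma pigeonhole_list (l : list T) (f : nat -> T) :
  (forall n, exists y, In y l /\ y == f n) ->
  exists a b, (a < b <= length l)%nat /\ f a == f b.
Proof.
  intros H. apply NNPP. intros N.
  set (c := fun n => proj1_sig (constructive_indefinite_description _ (H n))).
  assert (cP : forall n, In (c n) l /\ c n == f n)
    by (intros n; exact (proj2_sig (constructive_indefinite_description _ (H n)))).
  (* If no two values agreed, the representatives chosen for 0, ..., [length l] would be distinct
     members of [l], one too many. *)
  assert (D : NoDup (map c (seq 0 (S (length l))))).
  { apply (NoDup_nth _ (c 0)). rewrite length_map, length_seq. intros a b Ha Hb E.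
    rewrite !(map_nth c), !seq_nth in E by assumption. cbn in E.
    assert (F : f a == f b)
      by (rewrite <- (proj2 (cP a)), <- (proj2 (cP b)), E; reflexivity).
    destruct (Nat.lt_total a b) as [L|[L|L]]; [|exact L|]; exfalso; apply N.
    - exists a, b. split; [lia|exact F].
    - exists b, a. split; [lia|symmetry; exact F]. }
  apply NoDup_incl_length with (l' := l) in D.
  - rewrite length_map, length_seq in D. lia.
  - intros y Hy. apply in_map_iff in Hy as (n & <- & _). apply cP.
Qed.

Lemma divide_fact a n : (0 < a <= n)%nat -> (Z.of_nat a | Z.of_nat (fact n))%Z.
Proof.
  induction n as [|n IH]; intros H; [lia|].
  change (fact (S n)) with (S n * fact n)%nat. rewrite Nat2Z.inj_mul.
  destruct (Nat.eq_dec a (S n)) as [->|].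
  - apply Z.divide_factor_l.
  - apply Z.divide_mul_r, IH. lia.
Qed.

(** * Powers modulo a finite normal subgroup *)

Section FiniteNormal.
Context (E : T -> Prop) (E_eqv : forall x y, x == y -> E x -> E y)
  (E_id : E e) (E_op : forall x y, E x -> E y -> E (x * y))
  (E_inv : forall x, E x -> E (i x)) (E_conj : forall y x, E x -> E (y * x * i y)).
Context (l : list T) (E_fin : forall x, E x -> exists y, In y l /\ y == x).

(** Two of the powers of [x] with exponents 0, ..., [length l] coincide, and the difference of the
    two exponents divides the factorial. *)
Lemma fact_period x : E x -> x ^ Z.of_nat (fact (length l)) == e.
Proof.
  intros Hx.
  destruct (pigeonhole_list l (fun n => x ^ Z.of_nat n)) as (a & b & L & H).
  { intros n. apply E_fin, zpow_closed; auto. }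
  destruct (divide_fact (b - a) (length l)) as [q ->]; [lia|].
  rewrite Z.mul_comm, zpow_mul.
  replace (Z.of_nat (b - a)) with (- Z.of_nat a + Z.of_nat b)%Z by lia.
  rewrite zpow_add, <- H, zpow_opp, sg_invl. apply zpow_id.
Qed.

(** The conjugates of [x] by powers of [g] stay in the finite set E, so two of them coincide; then
    [g ^ (b - a)] commutes with [x], and [b - a] divides the factorial. *)
Lemma fact_centralizes g x : E x ->
  g ^ Z.of_nat (fact (length l)) * x == x * g ^ Z.of_nat (fact (length l)).
Proof.
  intros Hx.
  destruct (pigeonhole_list l (fun n => g ^ Z.of_nat n * x * i (g ^ Z.of_nat n)))
    as (a & b & L & H).
  { intros n. apply E_fin, E_conj, Hx. }
  destruct (divide_fact (b - a) (length l)) as [q ->]; [lia|].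
  rewrite Z.mul_comm, zpow_mul. apply zpow_comm.
  replace (Z.of_nat (b - a)) with (- Z.of_nat a + Z.of_nat b)%Z by lia.
  rewrite zpow_add, zpow_opp. revert H.
  generalize (g ^ Z.of_nat a) as u, (g ^ Z.of_nat b) as v. intros u v H.
  transitivity (i u * (v * x * i v) * v); [gsimpl; reflexivity|].
  rewrite <- H. gsimpl. reflexivity.
Qed.

Lemma zpow_mod_normal x y n :
  E (i x * y) -> E (i (x ^ Z.of_nat n) * y ^ Z.of_nat n).
Proof.
  intros H. induction n as [|n IH].
  - apply (E_eqv e); [cbn; gsimpl; reflexivity|exact E_id].
  - rewrite Nat2Z.inj_succ.
    apply (E_eqv (i (x ^ Z.of_nat n) * (i x * y) * i (i (x ^ Z.of_nat n))
      * (i (x ^ Z.of_nat n) * y ^ Z.of_nat n))); [|auto].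
    rewrite !zpow_succ. gsimpl. reflexivity.
Qed.

(* With M = |E|!, the power x^M centralizes E and E has exponent dividing M; so
   y = x mod E gives y^M = x^M z with z in E, and then y^(M M) = x^(M M) z^M. *)
Lemma zpow_determined_mod_finite x y :
  let M := Z.of_nat (fact (length l)) in
  E (i x * y) -> x ^ (M * M) == y ^ (M * M).
Proof.
  intros M H. apply (zpow_mod_normal x y (fact (length l))) in H.
  fold M in H. rewrite !zpow_mul.
  set (u := x ^ M) in *. set (z := i u * y ^ M) in *.
  assert (Ey : y ^ M == u * z) by (unfold z; rewrite sg_keyr; reflexivity).
  assert (C : u * z == z * u) by (apply fact_centralizes, H).
  rewrite Ey.
  assert (P : forall k, (u * z) ^ k == u ^ k * z ^ k).
  { intros k. induction k as [|k IH|k IH] using Z.peano_ind.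
    - cbn. rewrite sg_idl. reflexivity.
    - rewrite !zpow_succ, IH.
      rewrite sg_assoc_r, (sg_assoc z), <- (zpow_comm u z k C). gsimpl. reflexivity.
    - rewrite !zpow_pred, IH, C. gsimpl.
      rewrite (sg_assoc (i z)).
      rewrite <- (zpow_comm u (i z) k); [gsimpl; reflexivity|].
      rewrite <- (sg_keyl z (u * i z)), (sg_assoc z), <- C. gsimpl. reflexivity. }
  assert (z1 : z ^ M == e) by exact (fact_period z H).
  rewrite P, z1, sg_idr. reflexivity.
Qed.
End FiniteNormal.
End Group.

(** * Brace arithmetic, ideals and congruences *)

#[local] Arguments lam {B}.
#[local] Arguments cong {B}.
#[local] Arguments is_ideal {B}.
#[local] Arguments subset {B}.
#[local] Arguments zmul {B}.
#[local] Arguments in_zeta_quot {B}.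
#[local] Arguments in_soc_quot {B}.
#[local] Arguments quot_finite {B}.

Section BraceBasics.
Context {B : brace}.
Local Infix "+" := add.
Local Infix "*" := mul.
Local Notation "- x" := (opp x).
Local Notation "0" := (zero B).

Global Instance add_sgroup_eq : SGroup B eq add (zero B) opp.
Proof.
  constructor; [| |apply addA|apply add0r|apply addr0|apply addNr|apply addrN].
  - exact eq_equivalence.
  - intros ? ? -> ? ? ->. reflexivity.
Qed.

Global Instance mul_sgroup_eq : SGroup B eq mul (one B) inv.
Proof.
  constructor; [| |apply mulA|apply mul1r|apply mulr1|apply mulVr|apply mulrV].
  - exact eq_equivalence.
  - intros ? ? -> ? ? ->. reflexivity.
Qed.

Lemma addAr (a b c : B) : a + b + c = a + (b + c).
Proof. symmetry. apply addA. Qed.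
Lemma addKl (a b : B) : - a + (a + b) = b.
Proof. apply (sg_keyl (eqv := eq)). Qed.
Lemma addKr (a b : B) : a + (- a + b) = b.
Proof. apply (sg_keyr (eqv := eq)). Qed.
Lemma opp_add (a b : B) : - (a + b) = - b + - a.
Proof. apply (sg_op_inv (eqv := eq)). Qed.
Lemma opp_opp (a : B) : - - a = a.
Proof. apply (sg_inv_inv (eqv := eq)). Qed.
Lemma opp_zero : - 0 = 0.
Proof. apply (sg_inv_id (eqv := eq)). Qed.

Lemma mulAr (a b c : B) : a * b * c = a * (b * c).
Proof. symmetry. apply mulA. Qed.
Lemma mulKl (a b : B) : inv a * (a * b) = b.
Proof. apply (sg_keyl (eqv := eq)). Qed.
Lemma mulKr (a b : B) : a * (inv a * b) = b.
Proof. apply (sg_keyr (eqv := eq)). Qed.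
Lemma inv_mul (a b : B) : inv (a * b) = inv b * inv a.
Proof. apply (sg_op_inv (eqv := eq)). Qed.
Lemma inv_inv (a : B) : inv (inv a) = a.
Proof. apply (sg_inv_inv (eqv := eq)). Qed.

End BraceBasics.

Ltac asimpl := rewrite ?addAr, ?opp_add, ?opp_opp, ?opp_zero, ?addKl, ?addKr,
  ?add0r, ?addr0, ?addNr, ?addrN.
Ltac agroup := repeat progress asimpl; try reflexivity.
Ltac msimpl := rewrite ?mulAr, ?inv_mul, ?inv_inv, ?mulKl, ?mulKr,
  ?mul1r, ?mulr1, ?mulVr, ?mulrV.
Ltac mgroup := repeat progress msimpl; try reflexivity.

Existing Class is_ideal.

Section Ideals.
Context {B : brace}.
Local Infix "+" := add.
Local Infix "*" := mul.
Local Notation "- x" := (opp x).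
Local Notation "0" := (zero B).

(** Expanding [a * (0 + 0)] by the brace law and cancelling one [a * 0] leaves [- a + a * 0 = 0]. *)
Lemma mul_zero (a : B) : a * 0 = a.
Proof.
  assert (H := brace_law B a 0 0). rewrite add0r in H.
  assert (H' : - a + a * 0 = 0).
  { rewrite <- (addKl (a * 0) (- a + a * 0)), (addA _ (a * 0)), <- H. apply addNr. }
  rewrite <- (addKr a (a * 0)), H'. apply addr0.
Qed.

Lemma one_zero : one B = 0.
Proof. rewrite <- (mul_zero (one B)). apply mul1r. Qed.

Lemma mulE (a b : B) : a * b = a + lam a b.
Proof. unfold lam. agroup. Qed.

Lemma lam_add (a b c : B) : lam a (b + c) = lam a b + lam a c.
Proof. unfold lam. rewrite brace_law. agroup. Qed.

Lemma lam_zero (a : B) : lam a 0 = 0.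
Proof. unfold lam. rewrite mul_zero. agroup. Qed.

Lemma lam_opp (a b : B) : lam a (- b) = - lam a b.
Proof.
  apply (sg_inv_unique (eqv := eq)). rewrite <- lam_add, addNr. apply lam_zero.
Qed.

Lemma lam_mul (a b c : B) : lam (a * b) c = lam a (lam b c).
Proof.
  unfold lam at 3. rewrite lam_add, lam_opp. unfold lam. agroup. mgroup.
Qed.

Lemma lam_one (b : B) : lam (one B) b = b.
Proof. unfold lam. rewrite mul1r, one_zero. agroup. Qed.

Lemma lam_invK (a b : B) : lam a (lam (inv a) b) = b.
Proof. rewrite <- lam_mul, mulrV. apply lam_one. Qed.

Lemma lam_invK' (a b : B) : lam (inv a) (lam a b) = b.
Proof. rewrite <- lam_mul, mulVr. apply lam_one. Qed.

Lemma addE (a b : B) : a + b = a * lam (inv a) b.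
Proof. rewrite mulE, lam_invK. reflexivity. Qed.

Lemma invE (a : B) : inv a = - lam (inv a) a.
Proof.
  rewrite <- lam_opp. transitivity (lam (inv a) (lam a (inv a))).
  - symmetry. apply lam_invK'.
  - f_equal. unfold lam. rewrite mulrV, one_zero. apply addr0.
Qed.

(** Products and inverses come from the additive structure and [lam], through [a * b = a + lam a b]
    and [inv a = - lam (inv a) a]. *)
Lemma is_ideal_intro (I : B -> Prop) :
  I 0 -> (forall x y, I x -> I y -> I (x + y)) -> (forall x, I x -> I (- x)) ->
  (forall a x, I x -> I (a + x + - a)) -> (forall a x, I x -> I (lam a x)) ->
  (forall a x, I x -> I (a * x * inv a)) -> is_ideal I.
Proof.
  intros H0 HD HN HC HL HM. repeat split; auto.
  - intros x y Hx Hy. rewrite mulE. auto.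
  - intros x Hx. rewrite invE. auto.
Qed.

Section Closure.
Context (I : B -> Prop) {HI : is_ideal I}.
Lemma ideal_zero : I 0. Proof. apply HI. Qed.
Lemma ideal_add x y : I x -> I y -> I (x + y). Proof. apply HI. Qed.
Lemma ideal_opp x : I x -> I (- x). Proof. apply HI. Qed.
Lemma ideal_mul x y : I x -> I y -> I (x * y). Proof. apply HI. Qed.
Lemma ideal_inv x : I x -> I (inv x). Proof. apply HI. Qed.
Lemma ideal_conj a x : I x -> I (a + x + - a). Proof. apply HI. Qed.
Lemma ideal_mconj a x : I x -> I (a * x * inv a). Proof. apply HI. Qed.
Lemma ideal_lam a x : I x -> I (lam a x). Proof. apply HI. Qed.

Lemma ideal_lam_iff a x : I (lam a x) <-> I x.
Proof.
  split; [|apply ideal_lam]. intros H. rewrite <- (lam_invK' a x).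
  apply ideal_lam, H.
Qed.

(** The map [lam x] carries [inv x * y] to [- x + y] and preserves I, so additive and multiplicative
    cosets of an ideal coincide. *)
Lemma cong_mul_iff x y : cong I x y <-> I (inv x * y).
Proof.
  unfold cong. rewrite <- (ideal_lam_iff x (inv x * y)). unfold lam.
  rewrite mulKr. reflexivity.
Qed.

Lemma cong_zero x : cong I 0 x <-> I x.
Proof. unfold cong. rewrite opp_zero, add0r. reflexivity. Qed.

Global Instance cong_equiv : Equivalence (cong I).
Proof.
  unfold cong. split.
  - intros x. rewrite addNr. apply ideal_zero.
  - intros x y H. replace (- y + x) with (- (- x + y)) by agroup.
    apply ideal_opp, H.
  - intros x y z H H'. replace (- x + z) with ((- x + y) + (- y + z)) by agroup.
    apply ideal_add; assumption.
Qed.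

Global Instance add_proper : Proper (cong I ==> cong I ==> cong I) (@add B).
Proof.
  unfold cong. intros x x' Hx y y' Hy.
  replace (- (x + y) + (x' + y')) with ((- y + (- x + x') + - - y) + (- y + y'))
    by agroup.
  apply ideal_add; [apply ideal_conj|]; assumption.
Qed.

Global Instance mul_proper : Proper (cong I ==> cong I ==> cong I) (@mul B).
Proof.
  intros x x' Hx y y' Hy. rewrite cong_mul_iff in *.
  replace (inv (x * y) * (x' * y'))
    with ((inv y * (inv x * x') * inv (inv y)) * (inv y * y')) by mgroup.
  apply ideal_mul; [apply ideal_mconj|]; assumption.
Qed.

Lemma ideal_cong x y : cong I x y -> I x -> I y.
Proof. rewrite <- !cong_zero. intros H H'. rewrite H'. exact H. Qed.

Global Instance add_sgroup : SGroup B (cong I) add (zero B) opp.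
Proof.
  constructor; try exact _; intros; agroup.
Qed.

Global Instance mul_sgroup : SGroup B (cong I) mul (one B) inv.
Proof.
  constructor; try exact _; intros; mgroup.
Qed.

Global Instance lam_proper : Proper (cong I ==> cong I ==> cong I) (@lam B).
Proof.
  intros x x' Hx y y' Hy. unfold lam.
  apply add_proper; [apply sg_inv_proper; exact Hx|]. apply mul_proper; assumption.
Qed.

(** Modulo I the element [x] is zero, which is also the multiplicative identity. *)
Lemma ideal_in_zeta x y : I x ->
  cong I (lam x y) y /\ cong I (x + y) (y + x) /\ cong I (x * y) (y * x).
Proof.
  intros Hx. apply cong_zero in Hx. repeat split.
  - rewrite <- Hx, <- one_zero, lam_one. reflexivity.
  - rewrite <- Hx. agroup.
  - rewrite <- Hx, <- one_zero. mgroup.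
Qed.

Lemma ideal_in_zeta_r x y : I y ->
  cong I (lam x y) y /\ cong I (x + y) (y + x) /\ cong I (x * y) (y * x).
Proof.
  intros Hx. apply cong_zero in Hx. repeat split.
  - rewrite <- Hx, lam_zero. reflexivity.
  - rewrite <- Hx. agroup.
  - rewrite <- Hx, <- one_zero. mgroup.
Qed.
End Closure.

End Ideals.

Ltac ideal := solve [assumption | apply ideal_zero; ideal
  | apply ideal_conj; ideal | apply ideal_mconj; ideal | apply ideal_lam; ideal
  | apply ideal_add; ideal | apply ideal_opp; ideal
  | apply ideal_mul; ideal | apply ideal_inv; ideal].

(** * Intersections and sums of ideals *)

Section SumsOfIdeals.
Context {B : brace}.
Local Infix "+" := add.
Local Infix "*" := mul.
Local Notation "- x" := (opp x).
Local Notation "0" := (zero B).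

Lemma ideal_inter (I J : B -> Prop) : is_ideal I -> is_ideal J ->
  is_ideal (fun x => I x /\ J x).
Proof.
  unfold is_ideal. intuition auto.
Qed.

Definition isum (I J : B -> Prop) (z : B) := exists x y, I x /\ J y /\ z = x + y.

Lemma ideal_isum (I J : B -> Prop) : is_ideal I -> is_ideal J -> is_ideal (isum I J).
Proof.
  intros HI HJ. apply is_ideal_intro.
  - exists 0, 0. repeat split; [ideal..|symmetry; apply add0r].
  - intros ? ? (x & y & Hx & Hy & ->) (x' & y' & Hx' & Hy' & ->).
    exists (x + (y + x' + - y)), (y + y'). repeat split; [ideal..|].
    agroup.
  - intros ? (x & y & Hx & Hy & ->).
    exists (- y + - x + - - y), (- y). repeat split; [ideal..|].
    agroup.
  - intros a ? (x & y & Hx & Hy & ->).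
    exists (a + x + - a), (a + y + - a). repeat split; [ideal..|].
    agroup.
  - intros a ? (x & y & Hx & Hy & ->).
    exists (lam a x), (lam a y). repeat split; [ideal..|apply lam_add].
  - intros a ? (x & y & Hx & Hy & ->).
    (* Conjugation respects products, not sums: [x + y] is rewritten as [x * lam (inv x) y], both
       factors are conjugated, and the outer [lam] turns the product back into a sum. *)
    exists (a * x * inv a), (lam (a * x * inv a) (a * lam (inv x) y * inv a)).
    repeat split; [ideal..|].
    rewrite <- mulE, addE. mgroup.
Qed.

Lemma isum_l (I J : B -> Prop) : is_ideal J -> subset I (isum I J).
Proof.
  intros HJ x Hx. exists x, 0.
  repeat split; [ideal..|symmetry; apply addr0].
Qed.

Lemma isum_r (I J : B -> Prop) : is_ideal I -> subset J (isum I J).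
Proof.
  intros HI x Hx. exists 0, x.
  repeat split; [ideal..|symmetry; apply add0r].
Qed.
End SumsOfIdeals.

(** * Uniform powers and the ideal J + <N^2 g> *)

Definition finite_over {B : brace} (K J : B -> Prop) : Prop :=
  exists l : list B, forall x, K x -> exists y, In y l /\ cong J y x.

Section Powers.
Context {B : brace}.
Local Infix "+" := add.
Local Infix "*" := mul.
Local Notation "- x" := (opp x).
Local Notation "0" := (zero B).
Local Notation "x # k" := (zpow add (zero B) opp x k) (at level 30).
Local Notation "x ^ k" := (zpow mul (one B) inv x k).

Lemma lam_zpow (b x : B) k : lam b (x # k) = lam b x # k.
Proof. apply (zpow_morph (eqv := eq)); [congruence|apply lam_add]. Qed.

Lemma zpow_zpow (x : B) a b : (x # a) # b = x # (a * b).
Proof. symmetry. apply (zpow_mul (eqv := eq)). Qed.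

Lemma mpow_mpow (x : B) a b : (x ^ a) ^ b = x ^ (a * b).
Proof. symmetry. apply (zpow_mul (eqv := eq)). Qed.

Lemma ideal_zpow (I : B -> Prop) {HI : is_ideal I} x k : I x -> I (x # k).
Proof.
  apply (zpow_closed (eqv := eq)); intros; subst; ideal.
Qed.

(** Since [lam x] fixes [x] modulo J it fixes all its multiples, so multiplying by [x] adds [x] to
    them. *)
Lemma mpow_zpow (J : B -> Prop) {HJ : is_ideal J} x k :
  cong J (lam x x) x -> cong J (x ^ k) (x # k).
Proof.
  intros H.
  assert (S : forall k, cong J (x * x # k) (x # Z.succ k)).
  { intros m. rewrite mulE, lam_zpow, H. symmetry. apply (zpow_succ (eqv := cong J)). }
  induction k as [|k IH|k IH] using Z.peano_ind.
  - cbn. rewrite one_zero. reflexivity.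
  - rewrite <- S, <- IH. apply (zpow_succ (eqv := cong J)).
  - apply (sg_cancel_l (eqv := cong J) (op := mul) x).
    rewrite S, <- (zpow_succ (eqv := cong J)), Z.succ_pred. exact IH.
Qed.

(** The socle of B/E is an additive subgroup: for [x] in it [x * y] is [x + y], so [lam] of a sum is
    a composite and [- x] agrees with [inv x]. *)
Lemma soc_zpow (E : B -> Prop) {HE : is_ideal E} g k :
  in_soc_quot E g -> in_soc_quot E (g # k).
Proof.
  assert (L : forall x y, in_soc_quot E x -> cong E (x * y) (x + y)).
  { intros x y H. rewrite mulE. destruct (H y) as [-> _]. reflexivity. }
  apply (zpow_closed (eqv := cong E)).
  - intros x y Hxy H z. destruct (H z) as [H1 H2].
    rewrite <- Hxy. split; assumption.
  - intros z. rewrite <- one_zero at 1. rewrite lam_one. agroup. split; reflexivity.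
  - intros x y Hx Hy z. destruct (Hx z) as [Hx1 Hx2], (Hy z) as [Hy1 Hy2]. split.
    + rewrite <- L, lam_mul, Hy1 by exact Hx. exact Hx1.
    + rewrite addAr, Hy2, addA, Hx2. agroup.
  - intros x Hx z. destruct (Hx z) as [_ H2]. split.
    + assert (E1 : cong E (- x) (inv x)).
      { apply (sg_cancel_l (eqv := cong E) (op := add) x).
        rewrite addrN, <- L, mulrV, one_zero by exact Hx. reflexivity. }
      rewrite E1. destruct (Hx (lam (inv x) z)) as [H1 _].
      rewrite <- H1, lam_invK. reflexivity.
    + rewrite <- (addKl x (z + - x)), (addA _ x), H2. agroup.
Qed.

(** One exponent serves both groups of B/J: E is normal in both, and by [cong_mul_iff] the same list
    represents its cosets for either operation. *)
Lemma uniform_power (J E : B -> Prop) : is_ideal J -> is_ideal E -> subset J E ->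
  finite_over E J ->
  exists N : Z, (N <> 0)%Z /\
    (forall x y, cong E x y -> cong J (x # N) (y # N)) /\
    (forall x y, cong E x y -> cong J (x ^ N) (y ^ N)).
Proof.
  intros HJ HE JE [l Hl].
  exists (Z.of_nat (fact (length l)) * Z.of_nat (fact (length l)))%Z.
  assert (EJ : forall x y, cong J x y -> E x -> E y).
  { intros x y H. apply ideal_cong; [exact HE|apply JE, H]. }
  split; [|split].
  - assert (H := lt_O_fact (length l)). lia.
  - intros x y H.
    apply (zpow_determined_mod_finite (eqv := cong J) E); intros; try ideal; eauto.
  - intros x y H.
    apply (zpow_determined_mod_finite (eqv := cong J) E); intros;
      rewrite ?one_zero; try ideal; eauto.
    apply cong_mul_iff; assumption.
Qed.

Section CyclicIdeal.
Context (J E D : B -> Prop) {HJ : is_ideal J} {HE : is_ideal E} {HD : is_ideal D}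
  (JE : subset J E) (g : B) (Dg : D g)
  (D_cyclic : forall x, D x -> exists t : Z, cong E x (g # t))
  (g_soc : in_soc_quot E g) (N : Z)
  (N_add : forall x y, cong E x y -> cong J (x # N) (y # N))
  (N_mul : forall x y, cong E x y -> cong J (x ^ N) (y ^ N)).

(* The subgroup J + <N^2 g>. Squaring N is what makes it also the multiplicative
   subgroup generated by g^(N^2) modulo J. *)
Definition power_ideal (x : B) : Prop := exists k : Z, cong J x (g # (N * N * k)).

Lemma g_mpow k : cong E (g ^ k) (g # k).
Proof. apply mpow_zpow; [exact HE|apply g_soc]. Qed.

(** As [g # k] lies in the socle modulo E, it moves [g] only within its coset of E, and
    multiplication by N removes the difference modulo J. *)
Lemma lam_power k n : cong J (lam (g # k) (g # (N * n))) (g # (N * n)).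
Proof.
  rewrite lam_zpow, <- !zpow_zpow. apply zpow_proper; [|reflexivity].
  apply N_add. apply soc_zpow; assumption.
Qed.

Lemma power_mpow n k : cong J ((g # (N * n)) ^ k) (g # (N * n * k)).
Proof. rewrite (mpow_zpow J), zpow_zpow by apply lam_power. reflexivity. Qed.

(* N (N g) = (N g)^N = (g^N)^N modulo J, the second step because N g = g^N modulo E. *)
Lemma power_square : cong J (g # (N * N)) (g ^ (N * N)).
Proof.
  rewrite <- mpow_mpow, <- (N_mul (g # N)) by (symmetry; apply g_mpow).
  assert (P := power_mpow 1 N). rewrite Z.mul_1_r in P. symmetry. exact P.
Qed.

(** Each action sends [g] to a multiple of [g] modulo E, which a factor N lifts to a statement
    modulo J. For multiplicative conjugation, [power_square] first trades multiples for powers, so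
    that [N_mul] applies, and then trades back. *)
Lemma power_ideal_is_ideal : is_ideal power_ideal.
Proof.
  assert (NN : forall x y, cong E x y -> forall k,
    cong J (x # (N * N * k)) (y # (N * N * k))).
  { intros x y H k. rewrite <- !Z.mul_assoc, <- !(zpow_zpow _ N), (N_add x y H).
    reflexivity. }
  apply is_ideal_intro.
  - exists 0%Z. rewrite Z.mul_0_r. reflexivity.
  - intros x y [a Ha] [b Hb]. exists (a + b)%Z.
    rewrite Ha, Hb, Z.mul_add_distr_l, (zpow_add (eqv := cong J)). reflexivity.
  - intros x [a Ha]. exists (- a)%Z.
    rewrite Ha, Z.mul_opp_r, (zpow_opp (eqv := cong J)). reflexivity.
  - intros b x [a Ha]. exists a. rewrite Ha.
    rewrite (zpow_conj (eqv := cong J)). apply NN.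
    destruct (g_soc b) as [_ H]. rewrite <- H. agroup.
  - intros b x [a Ha]. destruct (D_cyclic (lam b g)) as [t Ht]; [ideal|].
    exists (t * a)%Z. rewrite Ha, lam_zpow, (NN _ _ Ht), zpow_zpow.
    replace (t * (N * N * a))%Z with (N * N * (t * a))%Z by ring. reflexivity.
  - intros b x [a Ha]. destruct (D_cyclic (b * g * inv b)) as [t Ht]; [ideal|].
    rewrite <- g_mpow in Ht. exists (t * a)%Z.
    rewrite Ha, <- power_mpow, power_square, mpow_mpow, (zpow_conj (eqv := cong J)).
    rewrite <- !mpow_mpow, (N_mul _ _ Ht), !mpow_mpow.
    replace (t * (N * (N * a)))%Z with (N * N * (t * a))%Z by ring.
    rewrite <- mpow_mpow, <- power_square. apply power_mpow.
Qed.

Lemma power_ideal_sub : subset J power_ideal.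
Proof. intros x Hx. exists 0%Z. rewrite Z.mul_0_r. symmetry. apply cong_zero, Hx. Qed.
End CyclicIdeal.
End Powers.

(** * Finite quotients and residual finiteness *)

Section Finiteness.
Context {B : brace}.
Local Infix "+" := add.
Local Notation "- x" := (opp x).
Local Notation "x # k" := (zpow add (zero B) opp x k) (at level 30).

Lemma finite_over_trans (D E J : B -> Prop) : is_ideal J ->
  finite_over D E -> finite_over E J -> finite_over D J.
Proof.
  intros HJ [l Hl] [l' Hl'].
  exists (map (fun p => fst p + snd p) (list_prod l l')).
  intros x Hx. destruct (Hl x Hx) as (y & Iy & Hy).
  destruct (Hl' (- y + x) Hy) as (z & Iz & Hz).
  exists (y + z). split.
  - apply in_map_iff. exists (y, z). split; [reflexivity|]. apply in_prod; assumption.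
  - rewrite Hz, addKr. reflexivity.
Qed.

Lemma finite_over_isum (E K' K : B -> Prop) : is_ideal E -> subset K E ->
  finite_over K' K -> finite_over (isum E K') E.
Proof.
  intros HE KE [l Hl]. exists l. intros ? (x & k & Hx & Hk & ->).
  destruct (Hl k Hk) as (y & Iy & Hy). exists y. split; [exact Iy|].
  apply KE in Hy. change (cong E y k) in Hy. apply (cong_zero E) in Hx.
  rewrite <- Hx, add0r. exact Hy.
Qed.

Lemma finite_over_cyclic (D E E' : B -> Prop) g n : is_ideal E' -> subset E E' ->
  (forall x, D x -> exists t : Z, cong E x (g # t)) ->
  n <> 0%Z -> E' (g # n) -> finite_over D E'.
Proof.
  intros HE' EE' HD n0 Hn.
  exists (map (fun r => g # Z.of_nat r) (seq 0 (Z.to_nat (Z.abs n)))).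
  intros x Hx. destruct (HD x Hx) as [t Ht].
  assert (B1 := Z.mod_pos_bound t (Z.abs n) ltac:(lia)).
  exists (g # (t mod Z.abs n)). split.
  - apply in_map_iff. exists (Z.to_nat (t mod Z.abs n)).
    rewrite Z2Nat.id by lia. split; [reflexivity|]. apply in_seq. lia.
  - apply EE' in Ht. change (cong E' x (g # t)) in Ht. rewrite Ht.
    assert (Ha : cong E' (g # Z.abs n) (zero B)).
    { symmetry. apply (cong_zero E').
      destruct (Z.abs_eq_or_opp n) as [-> | ->]; [exact Hn|].
      apply (ideal_cong E' (- (g # n))); [|ideal].
      symmetry. apply (zpow_opp (eqv := cong E')). }
    rewrite (Z_div_mod_eq_full t (Z.abs n)) at 2.
    rewrite (zpow_add (eqv := cong E')), (zpow_mul (eqv := cong E')), Ha.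
    rewrite (zpow_id (eqv := cong E')), add0r. reflexivity.
Qed.

(** Serves to pick a point in each intersection of a coset of I with a coset of J; some of these are
    empty, hence the case distinction. *)
Lemma finite_representatives (Ps : list (B -> Prop)) :
  exists l, forall P x, In P Ps -> P x -> exists y, In y l /\ P y.
Proof.
  induction Ps as [|P Ps [l IH]].
  - exists []. intros P x [].
  - destruct (classic (exists y, P y)) as [[y Hy]|N].
    + exists (y :: l). intros Q x [<-|HQ] Hx.
      * exists y. split; [left; reflexivity|exact Hy].
      * destruct (IH Q x HQ Hx) as (z & Iz & Hz). exists z. split; [right|]; assumption.
    + exists l. intros Q x [<-|HQ] Hx; [exfalso; apply N; exists x; exact Hx|].
      exact (IH Q x HQ Hx).
Qed.

Lemma quot_finite_inter (I J : B -> Prop) : is_ideal I -> is_ideal J ->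
  quot_finite I -> quot_finite J -> quot_finite (fun x => I x /\ J x).
Proof.
  intros HI HJ [l Hl] [l' Hl'].
  destruct (finite_representatives
    (map (fun p z => cong I (fst p) z /\ cong J (snd p) z) (list_prod l l'))) as [r Hr].
  exists r. intros b. destruct (Hl b) as (y & Iy & Hy), (Hl' b) as (y' & Iy' & Hy').
  destruct (Hr (fun z => cong I y z /\ cong J y' z) b) as (z & Iz & Hz & Hz').
  - apply in_map_iff. exists (y, y'). split; [reflexivity|]. apply in_prod; assumption.
  - split; assumption.
  - exists z. split; [exact Iz|]. split.
    + change (cong I z b). rewrite <- Hz. exact Hy.
    + change (cong J z b). rewrite <- Hz'. exact Hy'.
Qed.

Definition separable (A E : B -> Prop) : Prop :=
  exists L, is_ideal L /\ quot_finite L /\ forall x, L x -> E x -> A x.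

Definition chain_step (K D : B -> Prop) : Prop :=
  (quot_infinite_cyclic B D K /\ forall x, D x -> in_soc_quot K x) \/ finite_over D K.

(* Downward along the chain: a finite or torsion factor is absorbed into E, while for
   an infinite cyclic factor A is replaced by A + <N^2 g>, which meets E in A. *)
Lemma separable_step (K D : B -> Prop) : is_ideal K -> is_ideal D -> subset K D ->
  chain_step K D ->
  (forall A E, is_ideal A -> is_ideal E -> subset A E -> subset D E ->
     finite_over E A -> separable A E) ->
  forall A E, is_ideal A -> is_ideal E -> subset A E -> subset K E ->
     finite_over E A -> separable A E.
Proof.
  intros HK HD KD step IH A E HA HE AE KE fin.
  assert (HS := ideal_isum E D HE HD).
  assert (ES := isum_l E D HD). assert (DS := isum_r E D HE).
  assert (fin_case : finite_over (isum E D) E -> separable A E).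
  { intros f. destruct (IH A (isum E D)) as (L & HL & fL & LA); try assumption.
    - intros x Hx. apply ES, AE, Hx.
    - apply (finite_over_trans _ E); assumption.
    - exists L. auto. }
  destruct step as [[(g & Dg & gen & inf) soc]|f].
  2: { apply fin_case, (finite_over_isum E D K); assumption. }
  assert (cyc : forall x, isum E D x -> exists t : Z, cong E x (g # t)).
  { intros ? (x & d & Hx & Hd & ->). destruct (gen d Hd) as [t Ht]. exists t.
    apply KE in Ht. change (cong E d (g # t)) in Ht.
    apply (cong_zero E) in Hx. rewrite <- Hx, add0r. exact Ht. }
  destruct (classic (exists n, n <> 0%Z /\ E (g # n))) as [(n & n0 & Hn)|tf].
  { apply fin_case. apply (finite_over_cyclic _ E E g n); try assumption.
    intros x Hx; exact Hx. }
  destruct (uniform_power A E HA HE AE fin) as (N & N0 & Nadd & Nmul).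
  assert (gsoc : in_soc_quot E g).
  { intros y. destruct (soc g Dg y) as [H1 H2]. split; apply KE; assumption. }
  assert (HF : is_ideal (power_ideal A g N)).
  { apply (power_ideal_is_ideal A E (isum E D)); try assumption. apply DS, Dg. }
  assert (AF := power_ideal_sub A g N).
  destruct (IH (power_ideal A g N) (isum E D)) as (L & HL & fL & LF); try assumption.
  - intros x [k Hk]. apply (ideal_cong (isum E D) (g # (N * N * k))).
    + symmetry. apply ES, AE, Hk.
    + apply ideal_zpow; [exact HS|]. apply DS, Dg.
  (* Write F for the power ideal. (E + D)/(F + E) is finite because N^2 g lies in F, and (F + E)/F
     is finite because E/A is. *)
  - apply (finite_over_trans _ (isum (power_ideal A g N) E)); [exact HF| |].
    + apply (finite_over_cyclic _ E _ g (N * N)).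
      * apply ideal_isum; assumption.
      * apply isum_r, HF.
      * exact cyc.
      * lia.
      * apply isum_l; [exact HE|]. exists 1%Z. rewrite Z.mul_1_r. reflexivity.
    + apply (finite_over_isum _ E A); assumption.
  - exists L. split; [exact HL|]. split; [exact fL|]. intros x Lx Ex.
    destruct (LF x Lx (ES x Ex)) as [k Hk].
    (* An element of L and E is a multiple of [g] modulo A, and no nonzero multiple of [g] lies in
       E. *)
    assert (k0 : (N * N * k = 0)%Z).
    { apply NNPP. intros c. apply tf. exists (N * N * k)%Z. split; [exact c|].
      apply (ideal_cong E x); [apply AE, Hk|exact Ex]. }
    rewrite k0 in Hk. apply (cong_zero A). symmetry. exact Hk.
Qed.
End Finiteness.

(** * Centralizers of chain factors and central nilpotency *)

Section Centralizers.
Context {B : brace}.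
Local Infix "+" := add.
Local Infix "*" := mul.
Local Notation "x # k" := (zpow add (zero B) opp x k) (at level 30).
Local Notation "x ^ k" := (zpow mul (one B) inv x k).

(** One-sided in [lam]: D acts on C, matching [in_zeta_quot], where the element of the factor acts
    on the whole ideal. *)
Definition centralizes (C D K : B -> Prop) : Prop := forall x y, D x -> C y ->
  cong K (lam x y) y /\ cong K (x + y) (y + x) /\ cong K (x * y) (y * x).

(* Commutators of elements of D and L lie in both. A finite D/K is handled by
   separating D from K; for D/K = <g> infinite, separate D from K + <9 g>: then L
   acts on <g> by units of Z congruent to 1 modulo 9, hence trivially. *)
Lemma finite_index_centralizer (K D : B -> Prop) : is_ideal K -> is_ideal D ->
  subset K D -> chain_step K D ->
  (forall A E : B -> Prop, is_ideal A -> is_ideal E -> subset A E -> finite_over E A ->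
     separable A E) ->
  exists C, is_ideal C /\ quot_finite C /\ centralizes C D K.
Proof.
  intros HK HD KD step sep.
  destruct step as [[(g & Dg & gen & inf) soc]|f].
  2: { destruct (sep K D) as (L & HL & fL & LK); try assumption.
    exists L. split; [exact HL|]. split; [exact fL|]. intros x y Dx Ly.
    destruct (ideal_in_zeta D x y Dx) as (H1 & H2 & H3).
    destruct (ideal_in_zeta_r L x y Ly) as (H1' & H2' & H3').
    repeat split; apply LK; assumption. }
  assert (gen' : forall x, D x -> exists t : Z, cong K x (g # t)) by exact gen.
  (* With E = K the uniform-power hypotheses hold for every N. The choice N = 3 gives K + <9 g>, and
     9 does not divide 2 = 1 - (-1). *)
  assert (three : forall x y, cong K x y -> cong K (x # 3) (y # 3))
    by (intros x y ->; reflexivity).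
  assert (three' : forall x y, cong K x y -> cong K (x ^ 3) (y ^ 3))
    by (intros x y ->; reflexivity).
  assert (HF : is_ideal (power_ideal K g 3)).
  { apply (power_ideal_is_ideal K K D); auto. }
  assert (KF := power_ideal_sub K g 3).
  destruct (sep (power_ideal K g 3) D) as (L & HL & fL & LF); try assumption.
  { intros x [k Hk]. apply (ideal_cong D (g # (3 * 3 * k))).
    - symmetry. apply KD, Hk.
    - apply ideal_zpow; assumption. }
  { apply (finite_over_cyclic _ K _ g 9); try assumption; [lia|].
    exists 1%Z. reflexivity. }
  assert (inj : forall a b, cong K (g # a) (g # b) -> a = b).
  { intros a b H. enough (- a + b = 0)%Z by lia. apply inf.
    change (K (g # (- a + b))). apply (cong_zero K).
    rewrite (zpow_add (eqv := cong K)), (zpow_opp (eqv := cong K)), H, addNr.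
    reflexivity. }
  assert (gm : forall k, cong K (g ^ k) (g # k))
    by (intros k; apply (mpow_zpow K), (soc g Dg)).
  exists L. split; [exact HL|]. split; [exact fL|]. intros x y Dx Ly.
  destruct (soc x Dx y) as [Hlam Hadd]. split; [exact Hlam|]. split; [exact Hadd|].
  assert (conj_g : cong K (y * g * inv y) g).
  { destruct (gen' (y * g * inv y)) as [s Hs]; [ideal|].
    destruct (gen' (inv y * g * inv (inv y))) as [u Hu]; [ideal|].
    (* Conjugating by [y] and then back shows that [s] is a unit of Z. *)
    assert (su : (s * u = 1)%Z).
    { apply inj. rewrite <- gm, (zpow_mul (eqv := cong K)), (gm s), <- Hs.
      rewrite <- (zpow_conj (eqv := cong K)), gm, <- Hu. mgroup.
      symmetry. apply (zpow_1 (eqv := cong K)). }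
    assert (HF' : power_ideal K g 3 (opp (y * g * inv y) + g)).
    { apply LF.
      - change (cong L (y * g * inv y) g).
        destruct (ideal_in_zeta L y g Ly) as (_ & _ & ->). mgroup.
      - ideal. }
    destruct HF' as [k Hk].
    assert (s1 : (- s + 1 = 3 * 3 * k)%Z).
    { apply inj. rewrite <- Hk, (zpow_add (eqv := cong K)), (zpow_opp (eqv := cong K)).
      rewrite Hs, (zpow_1 (eqv := cong K)). reflexivity. }
    assert (s = 1%Z) as -> by (destruct (Z.eq_mul_1 s u su); lia).
    rewrite Hs. apply (zpow_1 (eqv := cong K)). }
  destruct (gen' x Dx) as [t Ht]. rewrite <- gm in Ht.
  apply (sg_cancel_r (eqv := cong K) (op := mul) (inv y)).
  rewrite Ht. rewrite (zpow_conj (eqv := cong K)), conj_g. mgroup.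
Qed.

(** For J = 0 this says that [K m] is a B-centrally nilpotent ideal of finite index. The chain
    starts inside J rather than at J, so intersecting its terms with another ideal keeps this
    form. *)
Definition nilpotent_modulo (J : B -> Prop) : Prop :=
  exists (m : nat) (K : nat -> B -> Prop),
    (forall j, j <= m -> is_ideal (K j)) /\
    quot_finite (K m) /\ subset (K 0) J /\
    (forall j, j < m -> subset (K j) (K (S j))) /\
    (forall j, j < m -> forall x, K (S j) x -> in_zeta_quot (K m) (K j) x).

(** All terms are intersected with C and a new bottom [K 0] meet J meet C is added. The new factor
    is central because [K 0] lies in D, which C centralizes modulo J; the others stay central
    because commutators of elements of C remain in C. *)
Lemma nilpotent_modulo_step (C D J : B -> Prop) : is_ideal J -> is_ideal C ->
  quot_finite C -> centralizes C D J -> nilpotent_modulo D -> nilpotent_modulo J.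
Proof.
  intros HJ HC fC cent (m & K & HK & fK & KD & Ksub & Kz).
  exists (S m), (fun j x => match j with
    | 0 => (K 0 x /\ J x) /\ C x | S j => K j x /\ C x end).
  split; [|split; [|split; [|split]]].
  - intros [|j] Hj; apply ideal_inter; try assumption.
    + apply ideal_inter; [apply HK; lia|exact HJ].
    + apply HK. lia.
  - apply quot_finite_inter; try assumption. apply HK. lia.
  - intros x [[_ Hx] _]. exact Hx.
  - intros [|j] Hj x.
    + intros [[H _] H']. split; assumption.
    + intros [H H']. split; [|exact H']. apply Ksub; [lia|exact H].
  - intros [|j] Hj x [Kx Cx] y [Ky Cy].
    + assert (HK0 : is_ideal (K 0)) by (apply HK; lia).
      destruct (cent x y (KD x Kx) Cy) as (H1 & H2 & H3).
      destruct (ideal_in_zeta (K 0) x y Kx) as (H1' & H2' & H3').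
      destruct (ideal_in_zeta C x y Cx) as (H1'' & H2'' & H3'').
      repeat split; assumption.
    + destruct (Kz j ltac:(lia) x Kx y Ky) as (H1 & H2 & H3).
      destruct (ideal_in_zeta C x y Cx) as (H1'' & H2'' & H3'').
      repeat split; assumption.
Qed.
End Centralizers.

(** * Descent along the supersoluble chain *)

Theorem theorem3p42 (B : brace) : supersoluble B -> @quot_finite B (Fit B).
Proof.
  intros (n & J & J0 & Jn & HJ & Jsub & Jstep).
  assert (step : forall i, i < n -> chain_step (J i) (J (S i))).
  { intros i Hi. destruct (Jstep i Hi) as [H|(p & _ & l & _ & _ & H & _)].
    - left. exact H.
    - right. exists l. exact H. }
  assert (sep : forall d i, i + d = n -> forall A E, is_ideal A -> is_ideal E ->
    subset A E -> subset (J i) E -> finite_over E A -> separable A E).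
  { induction d as [|d IH]; intros i Hi.
    (* At the top E is all of B, so A itself has finite index and can be taken for L. *)
    - intros A E HA HE AE JE [l Hl]. replace i with n in JE by lia.
      exists A. split; [exact HA|]. split; [|auto].
      exists l. intros b. apply Hl, JE, Jn.
    - apply (separable_step (J i) (J (S i))).
      + apply HJ. lia.
      + apply HJ. lia.
      + apply Jsub. lia.
      + apply step. lia.
      + apply IH. lia. }
  assert (nil : forall d i, i + d = n -> nilpotent_modulo (J i)).
  { induction d as [|d IH]; intros i Hi.
    (* At the top the chain consists of the single term B. *)
    - exists 0, (fun _ => J i).
      split; [|split; [|split; [|split; intros; lia]]].
      + intros j _. apply HJ. lia.
      + exists [zero B]. intros b. exists (zero B). split; [left; reflexivity|].
        replace i with n by lia. apply Jn.
      + intros x Hx. exact Hx.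
    - destruct (finite_index_centralizer (J i) (J (S i))) as (C & HC & fC & cent).
      + apply HJ. lia.
      + apply HJ. lia.
      + apply Jsub. lia.
      + apply step. lia.
      (* Separation is taken at the bottom of the chain, where [J 0] is zero and so lies in every
         E. *)
      + intros A E HA HE AE. apply (sep n 0); try assumption; [lia|].
        intros x Hx. apply J0 in Hx. subst x. ideal.
      + apply (nilpotent_modulo_step C (J (S i))); try assumption.
        * apply HJ. lia.
        * apply IH. lia. }
  (* At [J 0] the ideal [K m] is B-centrally nilpotent, hence inside [Fit B], so representatives of
     its finitely many cosets also represent those of [Fit B]. *)
  destruct (nil n 0 ltac:(lia)) as (m & K & HK & [l Hl] & K0 & Ksub & Kz).
  exists l. intros b. destruct (Hl b) as (y & Iy & Hy). exists y.
  split; [exact Iy|]. apply (Fit_gen (I := K m)); [|exact Hy].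
  split; [apply HK; lia|]. exists m, K. split; [|split; [|auto]].
  - intros x. split; [intros H; apply J0, K0, H|].
    intros ->. assert (is_ideal (K 0)) by (apply HK; lia). ideal.
  - intros x. reflexivity.
Qed.
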